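(* Let $\mathcal{X}$ be a finite non-empty set and let $\overline{T}$ be an upper transition operator on $\mathcal{L}(\mathcal{X})$. Then $\overline{T}$ is weakly ergodic if and only if $\overline{T}$ is top class absorbing (TCA).
   Context: $\mathcal{L}(\mathcal{X})$ is the set of all functions $\mathcal{X}\to\mathbb{R}$; inequalities and limits of functions are pointwise, and real constants are identified with constant functions. $\mathbb{N}=\{1,2,\dots\}$. $\mathbb{I}_A$ is the indicator of $A\subseteq\mathcal{X}$, and $\mathbb{I}_x:=\mathbb{I}_{\{x\}}$. $A^c:=\mathcal{X}\setminus A$. An upper transition operator is a map $\overline{T}:\mathcal{L}(\mathcal{X})\to\mathcal{L}(\mathcal{X})$ such that for all $h,g\in\mathcal{L}(\mathcal{X})$ and all real $\lambda\ge 0$: $\overline{T}h\le\max h$; $\overline{T}(h+g)\le\overline{T}h+\overline{T}g$; $\overline{T}(\lambda h)=\lambda\overline{T}h$. For $f\in\mathcal{L}(\mathcal{X})$ let $\overline{T}_f h:=f+\overline{T}h$ for all $h\in\mathcal{L}(\mathcal{X})$, and for $k\in\mathbb{N}$, $x\in\mathcal{X}$ let $\overline{E}_{\mathrm{av},k}(f\mid x):=\frac1k[\overline{T}_f^{\,k}(0)](x)$, where $\overline{T}_f^{\,k}$ is the $k$-th iterate. (This is the upper expected time average of $f$ over times $1,\dots,k$, starting in $x$, of an imprecise Markov chain under epistemic irrelevance or complete independence with upper transition operator $\overline{T}$.) $\overline{T}$ is weakly ergodic if for every $f\in\mathcal{L}(\mathcal{X})$ the limit $\lim_{k\to+\infty}\overline{E}_{\mathrm{av},k}(f\mid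 x)$ exists for all $x\in\mathcal{X}$ and does not depend on $x$. The graph $\mathscr{G}(\overline{T})$ is the directed graph with vertex set $\mathcal{X}$ and an edge from $x$ to $y$ iff $\overline{T}\mathbb{I}_y(x)>0$. Write $x\to y$ if $x=y$ or there is a directed path from $x$ to $y$. Communication classes are the equivalence classes of the relation ''$x\to y$ and $y\to x$''. For communication classes $A,B$ write $A\to B$ if $x\to y$ for some (equivalently all) $x\in A,y\in B$. A top class is a communication class $\mathcal{R}$ such that $A\to\mathcal{R}$ for every communication class $A$; equivalently, a top class exists iff $\{x\in\mathcal{X}: y\to x\ \forall y\in\mathcal{X}\}\neq\emptyset$, and it then equals this set. A non-empty $\mathcal{S}\subseteq\mathcal{X}$ is closed if $x\not\to y$ for all $x\in\mathcal{S}$, $y\in\mathcal{S}^c$ (a top class is closed). A closed $\mathcal{S}$ is absorbing if for every $x\in\mathcal{S}^c$ there is $k\in\mathbb{N}$ with $\overline{T}^{\,k}\mathbb{I}_{\mathcal{S}^c}(x)<1$. $\overline{T}$ is top class absorbing (TCA) if it has a top class and this top class is absorbing. *)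

(* Defs.v *)
From HB Require Import structures.
From mathcomp Require Import all_boot all_order all_algebra.
From mathcomp Require Import boolp classical_sets functions reals topology
  normedtype sequences numfun.
Import Order.TTheory GRing.Theory Num.Theory.
Import numFieldNormedType.Exports.
Set Implicit Arguments.
Unset Strict Implicit.
Unset Printing Implicit Defensive.
Local Open Scope ring_scope.

Section Defs.
Variables (R : realType) (X : finType).
Implicit Types (T : (X -> R) -> (X -> R)) (f g h : X -> R) (S : {set X}).

(* In the first clause, seeding the iterated maximum with [h x] makes it exactly
   the maximum of [h], because [x] is itself a point of [X]. *)
Definition upper_transition_operator T : Prop :=
  [/\ forall h x, T h x <= \big[Num.max/h x]_(y : X) h y,
      forall h g x, T (h \+ g) x <= T h x + T g x
    & forall (c : R) h x, 0 <= c -> T (fun y => c * h y) x = c * T h x].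

Definition shifted T f h : X -> R := f \+ T h.

(* Only meant for [0 < k]; the value for [k = 0] does not affect the limits. *)
Definition upper_expected_average T (k : nat) f (x : X) : R :=
  k%:R^-1 * iter k (shifted T f) (fun=> 0) x.

Definition weakly_ergodic T : Prop :=
  forall f,
    (forall x, cvgn (fun k => upper_expected_average T k f x)) /\
    (forall x y, limn (fun k => upper_expected_average T k f x)
               = limn (fun k => upper_expected_average T k f y)).

Definition indicator S : X -> R := \1_[set` S].

Definition edge T : rel X := fun x y => 0 < T (indicator [set y]) x.

Definition reaches T : rel X := connect (edge T).

Definition communicate T : rel X := fun x y => reaches T x y && reaches T y x.

Definition communication_classes T : {set {set X}} :=
  equivalence_partition (communicate T) [set: X].

Definition class_reaches T (A B : {set X}) : Prop :=
  exists x y, [/\ x \in A, y \in B & reaches T x y].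

Definition top_class T S : Prop :=
  S \in communication_classes T /\
  forall A, A \in communication_classes T -> class_reaches T A S.

Definition closed_set T S : Prop :=
  S != finset.set0 /\ forall x y, x \in S -> y \in ~: S -> ~~ reaches T x y.

Definition absorbing T S : Prop :=
  closed_set T S /\
  forall x, x \in ~: S ->
    exists2 k : nat, (0 < k)%N & iter k T (indicator (~: S)) x < 1.

(* A top class is unique when it exists. *)
Definition top_class_absorbing T : Prop :=
  exists2 S, top_class T S & absorbing T S.

End Defs.

(* Main.v *)
(** Write [v_k] for the [k]-th iterate of [h |-> f + T h] at [0]. Each [v_k] is
    almost invariant: [|T v_k - v_k| <= 2 max|f|]. If the top class [S] is
    absorbing, such functions have uniformly bounded oscillation: accessibility
    of [S] bounds [max_S v_k - min v_k], and absorption bounds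
    [max v_k - max_S v_k]. Hence [k |-> v_k x] is additive up to a constant,
    so [v_k x / k] converges, to a limit independent of [x].

    Conversely, let [S] be closed and [T^k I_{S^c}(x) >= 1] for all [k]. With
    [f = I_{S^c}], [v_k <= 0] on [S] whereas [v_k >= k T^k I_{S^c}], so the
    averages at [x] and on [S] have different limits. Thus weak ergodicity makes
    every closed set absorbing, which forces any two closed sets to meet; a
    minimal set of states reachable from one state is then the top class. *)

Require Import Defs.
From mathcomp Require Import all_boot all_order all_algebra.
From mathcomp Require Import boolp classical_sets functions reals topology
  normedtype sequences numfun.
From mathcomp Require Import lra.
Import Order.TTheory GRing.Theory Num.Theory.
Import numFieldNormedType.Exports.
Set Implicit Arguments.
Unset Strict Implicit.
Unset Printing Implicit Defensive.
Local Open Scope ring_scope.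

(** * Uniform constants and almost additive real sequences *)

Lemma finite_uniform_bound (R : numDomainType) (I : finType)
    (P : I -> R -> Prop) :
    (forall i K K', K <= K' -> P i K -> P i K') ->
    (forall i, exists2 K, 0 <= K & P i K) ->
  exists2 K, 0 <= K & forall i, P i K.
Proof.
move=> Pmono exP.
have /choice[K KP] : forall i, exists K, 0 <= K /\ P i K.
  by move=> i; have [K] := exP i; exists K.
exists (\sum_i K i); first by apply: sumr_ge0 => i _; case: (KP i).
move=> i; apply: (Pmono i (K i)); last by case: (KP i).
by rewrite (bigD1 i) //= lerDl; apply: sumr_ge0 => j _; case: (KP j).
Qed.

Lemma quasi_additive_linear (R : realType) (u : nat -> R) (C : R) :
    (forall m n, `|u (m + n)%N - u m - u n| <= C) ->
  exists l, forall n, `|u n - n%:R * l| <= C.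
Proof.
move=> uD.
have C0 : 0 <= C by apply: le_trans (uD 0 0)%N.
have uM m n : `|u (m.+1 * n)%N - m.+1%:R * u n| <= m%:R * C.
  elim: m => [|m IHm]; first by rewrite mul1n mul1r subrr normr0 mul0r.
  have := uD n (m.+1 * n)%N; rewrite -mulSn -[m.+2%:R]natr1.
  rewrite -[m.+1%:R in X in _ -> X]natr1.
  move: IHm; rewrite -[m.+1%:R]natr1 !ler_norml => /andP[? ?] /andP[? ?].
  by apply/andP; split; lra.
(* [u + C] is subadditive and [u - C] superadditive, so every [(u m - C) / m]
   lies below every [(u n + C) / n]; the slope is any separating number. *)
pose E : set R := range (fun m => (u m.+1 - C) / m.+1%:R).
have leE m n : (u m.+1 - C) / m.+1%:R <= (u n.+1 + C) / n.+1%:R.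
  rewrite ler_pdivrMr ?ltr0n// mulrAC ler_pdivlMr ?ltr0n//.
  (* Both bounds concern [u] at the product of the two indices, which links [u m.+1] to [u n.+1]. *)
  have := uM m n.+1; have := uM n m.+1; rewrite mulnC -!natr1 !ler_norml.
  by move=> /andP[? ?] /andP[? ?]; lra.
have ubE n : ubound E ((u n.+1 + C) / n.+1%:R).
  by move=> _ [m _ <-]; exact: leE.
exists (sup E) => -[|n].
  by have := uD 0 0%N; rewrite addn0 mul0r subr0 subrr add0r normrN.
have lE : (u n.+1 - C) / n.+1%:R <= sup E.
  by apply: ub_le_sup; [exists ((u 1%N + C) / 1) ; exact: (ubE 0%N)|exists n].
have El : sup E <= (u n.+1 + C) / n.+1%:R.
  by apply: ge_sup; [exists ((u 1%N - C) / 1); exists 0%N|exact: ubE].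
move: lE El; rewrite ler_pdivrMr ?ltr0n// ler_pdivlMr ?ltr0n// => ? ?.
by rewrite ler_norml; apply/andP; split; lra.
Qed.

Lemma cvg_average (R : realType) (u : nat -> R) (l C : R) :
    (forall n, `|u n - n%:R * l| <= C) ->
  (k%:R^-1 * u k @[k --> \oo] --> l)%classic.
Proof.
move=> uC; have C0 : 0 <= C := le_trans (normr_ge0 _) (uC 0%N).
(* The shift skips [k = 0] and matches [harmonic], whose [k]-th term is [1 / k.+1]. *)
rewrite -(cvg_shiftS (fun k => k%:R^-1 * u k)).
have C_n : (C * harmonic k @[k --> \oo] --> (0 : R))%classic.
  by rewrite -(mulr0 C); apply: cvgMr; exact: cvg_harmonic.
apply: cvg_sub0 (cvg_cst l).
apply: (squeeze_cvgr (f := fun k => - (C * harmonic k)) _ _ C_n).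
  apply: nearW => k /=; rewrite -ler_norml /harmonic /=.
  rewrite [X in `|X|](_ : _ = (u k.+1 - k.+1%:R * l) * k.+1%:R^-1); last first.
    by rewrite mulrBl mulrC [_ * l]mulrC mulfK ?pnatr_eq0.
  by rewrite normrM [`|_^-1|]gtr0_norm ?invr_gt0 ?ltr0n// ler_wpM2r ?invr_ge0.
by rewrite -(oppr0 R); apply: cvgN.
Qed.

(** * Elementary properties of upper transition operators *)

Section UpperTransitionOperator.
Variables (R : realType) (X : finType) (T : (X -> R) -> (X -> R)).
Hypothesis T_upper : upper_transition_operator T.
Implicit Types (f g h : X -> R) (S : {set X}) (c : R) (x y z : X).

Lemma indicatorE S x : indicator R S x = (x \in S)%:R.
Proof.
by rewrite /indicator indicE; congr (nat_of_bool _)%:R; apply/asboolP/idP.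
Qed.

Lemma upper_le_const h c x : (forall y, h y <= c) -> T h x <= c.
Proof.
by case: T_upper => Tmax _ _ hc; apply: le_trans (Tmax h x) _; apply: bigmax_le.
Qed.

Lemma upper_le h g x : (forall y, h y <= g y) -> T h x <= T g x.
Proof.
case: T_upper => _ Tsub _ hg.
have -> : h = g \+ (h \- g) by apply/funext => y /=; rewrite addrC subrK.
apply: le_trans (Tsub _ _ _) _; rewrite gerDl.
by apply: upper_le_const => y /=; rewrite subr_le0.
Qed.

Lemma upper_addc h c : T (fun y => c + h y) = (fun x => c + T h x).
Proof.
case: T_upper => _ Tsub _; apply/funext => x; apply/eqP; rewrite eq_le.
apply/andP; split.
  apply: le_trans (Tsub (fun=> c) h x) _; rewrite lerD2r.
  exact: upper_le_const.
have -> : h = (fun=> - c) \+ (fun y => c + h y).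
  by apply/funext => y /=; rewrite addKr.
rewrite -lerBrDl [leRHS]addrC; apply: le_trans (Tsub _ _ _) _.
rewrite (_ : (fun y => c + _) = fun y => c + h y); last first.
  by apply/funext => y /=; rewrite addKr.
by rewrite lerD2r; apply: upper_le_const.
Qed.

Lemma upper_affine h a c : 0 <= a ->
  T (fun y => c + a * h y) = (fun x => c + a * T h x).
Proof.
move=> a0; rewrite upper_addc; apply/funext => x; congr (_ + _).
by case: T_upper => _ _; apply.
Qed.

Lemma iter_upper_le j h g x :
  (forall y, h y <= g y) -> iter j T h x <= iter j T g x.
Proof. by elim: j x => //= j IHj x hg; apply: upper_le => y; apply: IHj. Qed.

Lemma iter_upper_affine j h a c : 0 <= a ->
  iter j T (fun y => c + a * h y) = (fun x => c + a * iter j T h x).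
Proof. by move=> a0; elim: j => //= j ->; rewrite upper_affine. Qed.

Lemma upper_ge0 h x : (forall y, 0 <= h y) -> 0 <= T h x.
Proof.
case: T_upper => _ _ TM h0; have := TM 0 h x (lexx _); rewrite mul0r => <-.
by apply: upper_le => y; rewrite mul0r.
Qed.

Lemma upper_sum (I : Type) (r : seq I) (P : pred I) (h : I -> X -> R) x :
  T (fun y => \sum_(i <- r | P i) h i y) x <= \sum_(i <- r | P i) T (h i) x.
Proof.
case: T_upper => _ Tsub _; elim: r => [|i r IHr].
  by rewrite big_nil; apply: upper_le_const => y; rewrite big_nil.
rewrite big_cons; under eq_fun do rewrite big_cons.
case: ifP => // _; exact: le_trans (Tsub _ _ _) (lerD (lexx _) IHr).
Qed.

(** Induction along a path with first edge [x -> z]: [T^j I_y] dominates its value at [z] times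
    [I_z], and [T I_z x > 0]. *)
Lemma reaches_iter_upper x y : reaches T x y ->
  exists j, 0 < iter j T (indicator R [set y]) x.
Proof.
case/connectP => p; elim: p x => [|z p IHp] x /=.
  by move=> _ ->; exists 0%N; rewrite /= indicatorE set11.
case/andP => xz zp /(IHp _ zp)[j jz]; exists j.+1 => /=.
have g0 i w : 0 <= iter i T (indicator R [set y]) w.
  by elim: i w => [|i IHi] w; [rewrite /= indicatorE|apply: upper_ge0].
apply: (@lt_le_trans _ _
  (T (fun w => 0 + iter j T (indicator R [set y]) z *
                   indicator R [set z] w) x)).
  by rewrite upper_affine ?g0// add0r mulr_gt0.
apply: upper_le => w; rewrite add0r indicatorE finset.in_set1.
by case: eqP => [->|_]; rewrite ?mulr1 ?mulr0.
Qed.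

(** * Oscillation of almost invariant functions *)

Definition almost_invariant c h := forall x, `|T h x - h x| <= c.

Lemma almost_invariant_iter c h j x : almost_invariant c h ->
  `|iter j T h x - h x| <= j%:R * c.
Proof.
move=> hc; elim: j x => [|j IHj] x /=; first by rewrite subrr normr0 mul0r.
have lb : T (fun y => - (j%:R * c) + 1 * h y) x <= T (iter j T h) x.
  apply: upper_le => y; have := IHj y; rewrite ler_norml => /andP[? _]; lra.
have ub : T (iter j T h) x <= T (fun y => (j%:R * c) + 1 * h y) x.
  apply: upper_le => y; have := IHj y; rewrite ler_norml => /andP[_ ?]; lra.
move: lb ub (hc x); rewrite !upper_affine// -natr1 !ler_norml => ? ? /andP[? ?].
by apply/andP; split; lra.
Qed.

Lemma almost_invariant_ge0 c h x : almost_invariant c h -> 0 <= c.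
Proof. by move=> /(_ x); apply: le_trans. Qed.

(** With [h x] minimal, [h >= h x + (h y - h x) I_y]. Applying [T^j] at [x], where
    [d = T^j I_y x > 0], gives [(h y - h x) d <= j c]; hence [K = j / d], independent of [h]. *)
Lemma almost_invariant_le_min x y : reaches T x y ->
  exists2 K, 0 <= K & forall c h, almost_invariant c h ->
    (forall z, h x <= h z) -> h y <= h x + K * c.
Proof.
case/reaches_iter_upper => j; set d := iter _ _ _ _ => d0.
exists (j%:R / d) => [|c h hc xmin]; first by rewrite divr_ge0 ?(ltW d0).
have := almost_invariant_iter j x hc; rewrite ler_norml => /andP[_ le_jc].
have : iter j T (fun z => h x + (h y - h x) * indicator R [set y] z) x
    <= iter j T h x.
  apply: iter_upper_le => z; rewrite indicatorE finset.in_set1.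
  by case: eqP => [->|_]; rewrite ?mulr1 ?mulr0 ?addr0 ?xmin// addrC subrK.
rewrite iter_upper_affine ?subr_ge0// -/d => ?.
by rewrite -lerBlDl mulrAC ler_pdivlMr//; lra.
Qed.

(** Here [h <= h y + (h x - h y) I_{S^c}]. Applying [T^j] at [x], where [e = T^j I_{S^c} x < 1],
    gives [(h x - h y) (1 - e) <= j c]. *)
Lemma almost_invariant_max_le S x : absorbing T S ->
  exists2 K, 0 <= K & forall c h, almost_invariant c h ->
    (forall z, h z <= h x) ->
    forall y, y \in S -> (forall z, z \in S -> h z <= h y) ->
    h x <= h y + K * c.
Proof.
case=> _ Sabs; have [xS|xS] := boolP (x \in S).
  exists 0 => // c h _ _ y _ ymax; rewrite mul0r addr0; exact: ymax.
have [|j _] := Sabs x; first by rewrite finset.in_setC.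
set e := iter _ _ _ _ => e1; have d0 : 0 < 1 - e by rewrite subr_gt0.
exists (j%:R / (1 - e)) => [|c h hc xmax y yS ymax].
  by rewrite divr_ge0 ?(ltW d0).
have := almost_invariant_iter j x hc; rewrite ler_norml => /andP[ge_jc _].
have : iter j T h x
    <= iter j T (fun z => h y + (h x - h y) * indicator R (~: S) z) x.
  apply: iter_upper_le => z; rewrite indicatorE finset.in_setC.
  have [zS|zS] := boolP (z \in S); first by rewrite mulr0 addr0 ymax.
  by rewrite mulr1 addrC subrK.
rewrite iter_upper_affine ?subr_ge0// -/e => ?.
by rewrite -lerBlDl mulrAC ler_pdivlMr//; lra.
Qed.

Lemma almost_invariant_oscillation S : absorbing T S ->
    (forall x y, y \in S -> reaches T x y) ->
  exists2 K, 0 <= K & forall c h, almost_invariant c h ->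
    forall x y, h x <= h y + K * c.
Proof.
move=> Sabs Stop.
(* The extremal points vary with [h], so the constants are first made uniform over all points. *)
have [|p|K1 K1_ge0 K1P] := finite_uniform_bound (I := (X * X)%type)
  (P := fun p K => p.2 \in S -> forall c h, almost_invariant c h ->
    (forall z, h p.1 <= h z) -> h p.2 <= h p.1 + K * c).
- move=> p K K' KK' PK pS c h hc pmin; apply: le_trans (PK pS c h hc pmin) _.
  by rewrite lerD2l ler_wpM2r// (almost_invariant_ge0 p.1 hc).
- have [pS|pS] := boolP (p.2 \in S); last by exists 0.
  by have [K] := almost_invariant_le_min (Stop p.1 _ pS); exists K.
have [|x|K2 K2_ge0 K2P] := finite_uniform_bound (P := fun x K =>
    forall c h, almost_invariant c h -> (forall z, h z <= h x) ->
    forall y, y \in S -> (forall z, z \in S -> h z <= h y) ->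
    h x <= h y + K * c).
- move=> x K K' KK' PK c h hc xmax y yS ymax.
  apply: le_trans (PK c h hc xmax y yS ymax) _.
  by rewrite lerD2l ler_wpM2r// (almost_invariant_ge0 x hc).
- exact: almost_invariant_max_le.
exists (K1 + K2) => [|c h hc x y]; first exact: addr_ge0.
have /set0Pn[s0 s0S] : S != finset.set0 by case: Sabs => -[].
pose a := [arg min_(z < s0) h z]%O; pose b := [arg max_(z > s0) h z]%O.
pose s := [arg max_(z > s0 in S) h z]%O.
have amin z : h a <= h z by rewrite /a; case: arg_minP => // i _; apply.
have bmax z : h z <= h b by rewrite /b; case: arg_maxP => // i _; apply.
have [sS smax] : s \in S /\ forall z, z \in S -> h z <= h s.
  by rewrite /s; case: arg_maxP.
have /= ? := K1P (a, s) sS c h hc amin.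
have ? := K2P b c h hc bmax s sS smax.
by move: (amin y) (bmax x); lra.
Qed.

(** * Iterates of [h |-> f + T h] started at [0] *)

Notation orbit f k := (iter k (shifted T f) (fun=> 0)).

Lemma shifted_le f h g x :
  (forall y, h y <= g y) -> shifted T f h x <= shifted T f g x.
Proof. by move=> hg; rewrite /shifted /= lerD2l upper_le. Qed.

Lemma iter_shifted_le f j h g x :
  (forall y, h y <= g y) ->
  iter j (shifted T f) h x <= iter j (shifted T f) g x.
Proof. by elim: j x => //= j IHj x hg; apply: shifted_le => y; apply: IHj. Qed.

Lemma shifted_addc f h c :
  shifted T f (fun y => c + h y) = (fun x => c + shifted T f h x).
Proof.
by rewrite /shifted upper_addc; apply/funext => x /=; rewrite addrCA.
Qed.

Lemma iter_shifted_addc f j h c :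
  iter j (shifted T f) (fun y => c + h y) =
  (fun x => c + iter j (shifted T f) h x).
Proof. by elim: j => //= j ->; rewrite shifted_addc. Qed.

(** [shifted T f] is monotone and commutes with adding constants, so it is nonexpansive for the sup
    norm: no increment exceeds the bound on the first one, [f]. *)
Lemma shifted_orbit_step f (B : R) : (forall x, `|f x| <= B) ->
  forall k x, `|orbit f k.+1 x - orbit f k x| <= B.
Proof.
move=> fB; elim=> [|k IHk] x.
  rewrite /= subr0 /shifted /=.
  have -> : T (fun=> 0) x = 0; last by rewrite addr0.
  by apply/eqP; rewrite eq_le upper_le_const// upper_ge0.
rewrite !iterS in IHk *; move: (orbit f k) IHk => h IHh.
rewrite ler_norml; apply/andP; split.
  have : shifted T f (fun y => - B + h y) x <= shifted T f (shifted T f h) x.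
    by apply: shifted_le => y; have := IHh y; rewrite ler_norml => /andP[]; lra.
  by rewrite shifted_addc; lra.
have : shifted T f (shifted T f h) x <= shifted T f (fun y => B + h y) x.
  by apply: shifted_le => y; have := IHh y; rewrite ler_norml => /andP[]; lra.
by rewrite shifted_addc; lra.
Qed.

Lemma shifted_orbit_almost_invariant f (B : R) : (forall x, `|f x| <= B) ->
  forall k, almost_invariant (2 * B) (orbit f k).
Proof.
move=> fB k x; move: (shifted_orbit_step fB k x) (fB x).
rewrite /= {1}/shifted /= !ler_norml => /andP[? ?] /andP[? ?].
by apply/andP; split; lra.
Qed.

Lemma bounded_oscillation_linear f (C : R) : (0 < #|X|)%N ->
    (forall k x y, orbit f k x <= orbit f k y + C) ->
  exists l C', forall x k, `|orbit f k x - k%:R * l| <= C'.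
Proof.
case/card_gt0P => x0 _ osc.
have [m n|l lP] := @quasi_additive_linear _ (fun k => orbit f k x0) C.
  rewrite iterD ler_norml; apply/andP; split.
    (* [orbit f n] lies within [C] of its value at [x0]; the [+ 0] presents that constant as a
       translate of the starting function [0]. *)
    have : iter m (shifted T f) (fun y => orbit f n x0 - C + 0) x0
        <= iter m (shifted T f) (orbit f n) x0.
      by apply: iter_shifted_le => y; have := osc n x0 y; lra.
    by rewrite iter_shifted_addc; lra.
  have : iter m (shifted T f) (orbit f n) x0
      <= iter m (shifted T f) (fun y => orbit f n x0 + C + 0) x0.
    by apply: iter_shifted_le => y; have := osc n y x0; lra.
  by rewrite iter_shifted_addc; lra.
exists l, (C + C) => x k; move: (lP k) (osc k x x0) (osc k x0 x).
by rewrite !ler_norml => /andP[? ?] ? ?; apply/andP; split; lra.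
Qed.

(** * From an absorbing top class to weak ergodicity *)

Lemma top_class_reaches S : top_class T S ->
  forall x y, y \in S -> reaches T x y.
Proof.
case=> /imsetP[z _ ->] Stop x y; rewrite !inE /= => /andP[zy _].
have [|x' [y' []]] := Stop [set w in [set: X] | communicate T x w].
  by apply/imsetP; exists x.
rewrite !inE /= => /andP[xx' _] /andP[_ y'z] x'y'.
exact: connect_trans (connect_trans xx' x'y') (connect_trans y'z zy).
Qed.

Lemma top_class_absorbing_weakly_ergodic : (0 < #|X|)%N ->
  top_class_absorbing T -> weakly_ergodic T.
Proof.
move=> X0 [S Stop Sabs] f.
have [K K0 KP] := almost_invariant_oscillation Sabs (top_class_reaches Stop).
have fB x : `|f x| <= \sum_y `|f y|.
  by rewrite (bigD1 x) //= lerDl sumr_ge0.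
pose B := \sum_y `|f y|; rewrite -/B in fB.
have [k x y|l [C lP]] := @bounded_oscillation_linear f (K * (2 * B)) X0.
  exact: KP (shifted_orbit_almost_invariant fB k) x y.
have fl x : (upper_expected_average T k f x @[k --> \oo] --> l)%classic.
  exact: cvg_average (lP x).
split=> [x|x y]; first by apply: cvgP (fl x).
by rewrite !(cvg_lim _ (fl _)).
Qed.

(* On a closed set, the value of [T h] only depends on [h] there. *)
Lemma closed_set_upper0 S h x : closed_set T S -> x \in S ->
  (forall y, y \in S -> h y <= 0) -> T h x <= 0.
Proof.
case=> _ Scl xS h0; case: T_upper => _ _ TM.
(* [h] is dominated by the sum of [|h y| I_y] over [y] outside [S]; no edge leaves [S], so each
   [T I_y x <= 0]. *)
pose g y z : R := `|h y| * indicator R [set y] z.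
apply: (@le_trans _ _ (T (fun z => \sum_(y in ~: S) g y z) x)).
  apply: upper_le => z; have [zS|zS] := boolP (z \in S).
    apply: le_trans (h0 _ zS) _; apply: sumr_ge0 => y _.
    by rewrite mulr_ge0// indicatorE.
  rewrite (bigD1 z) ?finset.in_setC//= /g indicatorE set11 mulr1.
  rewrite (le_trans (ler_norm _))// lerDl sumr_ge0// => y _.
  by rewrite mulr_ge0// indicatorE.
apply: le_trans (upper_sum _ _ _ _) _.
apply: sumr_le0 => y yS; rewrite TM// mulr_ge0_le0// leNgt.
by apply: contra (Scl _ _ xS yS) => xy; apply: connect1.
Qed.

(** * From weak ergodicity to an absorbing top class *)

Lemma weakly_ergodic_closed_absorbing S : weakly_ergodic T ->
  closed_set T S -> absorbing T S.
Proof.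
move=> Twe Scl; split=> // x; rewrite finset.in_setC => xS.
apply: contrapT => nabs.
have gx k : 1 <= iter k T (indicator R (~: S)) x.
  case: k => [|k]; first by rewrite /= indicatorE finset.in_setC xS.
  by rewrite leNgt; apply/negP => lt1; apply: nabs; exists k.+1.
set f := indicator R (~: S) in gx.
have f0 y : y \in S -> f y = 0.
  by move=> yS; rewrite /f indicatorE finset.in_setC yS.
have f1 y : f y <= 1 by rewrite /f indicatorE lern1 leq_b1.
(* The iterates decrease because [T f <= f]: off [S], [f = 1]; on [S], closedness gives
   [T f <= 0]. *)
have gS k y : iter k.+1 T f y <= iter k T f y.
  elim: k y => [|k IHk] y /=; last exact: upper_le.
  have [yS|yS] := boolP (y \in S); last first.
    rewrite {2}/f indicatorE finset.in_setC yS; exact: upper_le_const.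
  rewrite [leRHS]f0//; apply: (closed_set_upper0 Scl yS) => z zS; by rewrite f0.
have gf k y : iter k T f y <= f y.
  by elim: k => // k IHk; apply: le_trans (gS k y) IHk.
(* Induction: [f + T v_k >= f + k T^(k+1) f], and [f >= T^(k+1) f]. *)
have v_ge k y : k%:R * iter k T f y <= orbit f k y.
  elim: k y => [|k IHk] y; first by rewrite mul0r.
  have : shifted T f (fun y => 0 + k%:R * iter k T f y) y <= orbit f k.+1 y.
    by apply: shifted_le => z; rewrite add0r.
  apply: le_trans; rewrite /shifted upper_affine//= add0r -natr1 mulrDl mul1r.
  by rewrite addrC lerD2r (gf k.+1).
have v_le k y : y \in S -> orbit f k y <= 0.
  elim: k y => // k IHk y yS /=; rewrite /shifted /= f0// add0r.
  exact: closed_set_upper0 Scl yS IHk.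
have /set0Pn[s sS] : S != finset.set0 by case: Scl.
have [cvf limf] := Twe f.
have : limn (fun k => upper_expected_average T k f s) <= 0.
  apply: limr_le => //; apply: nearW => k.
  by rewrite mulr_ge0_le0 ?invr_ge0 ?v_le.
rewrite (limf s x); apply/negP; rewrite -ltNge (lt_le_trans ltr01)//.
(* The average at [k = 0] is [0], so the lower bound [1] starts at [k = 1]. *)
apply: limr_ge => //; exists 1%N => // k /= k0.
rewrite /upper_expected_average ler_pdivlMl ?ltr0n// mulr1.
by apply: le_trans (v_ge k x); rewrite ler_peMr.
Qed.

Definition reachable_set x : {set X} := [set y | reaches T x y].

Lemma reachable_set_closed x : closed_set T (reachable_set x).
Proof.
split; first by apply/set0Pn; exists x; rewrite inE; apply: connect0.
move=> y z; rewrite !inE => xy; apply: contra => yz; exact: connect_trans xy yz.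
Qed.

(** If the sets were disjoint, then [I_S <= I_{S'^c}], while [T^k I_S >= 1] on the closed set [S],
    against absorption by [S']. *)
Lemma closed_absorbing_meet S S' : closed_set T S -> absorbing T S' ->
  exists2 x, x \in S & x \in S'.
Proof.
move=> Scl [_ S'abs]; apply: contrapT => disj.
have SS' y : y \in S -> y \in ~: S'.
  move=> yS; rewrite finset.in_setC; apply/negP => yS'.
  by apply: disj; exists y.
have /set0Pn[x xS] : S != finset.set0 by case: Scl.
have [k _] := S'abs x (SS' x xS); apply/negP; rewrite -leNgt.
suff iS y : y \in S -> 1 <= iter k T (indicator R S) y.
  apply: le_trans (iS x xS) _; apply: iter_upper_le => y; rewrite !indicatorE.
  by case: (boolP (y \in S)) => // /SS' ->.
elim: k y => [|k IHk] y yS /=; first by rewrite indicatorE yS.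
(* For [g = T^k I_S], closedness gives [1 + T (- g) <= 0] on [S], and
   [0 = T (g - g) <= T g + T (- g)]; hence [T g >= 1] there. *)
have : T (fun z => 1 + - iter k T (indicator R S) z) y <= 0.
  by apply: (closed_set_upper0 Scl yS) => z zS; rewrite subr_le0 IHk.
rewrite upper_addc; case: T_upper => _ Tsub _.
have := Tsub (iter k T (indicator R S))
  (fun z => - iter k T (indicator R S) z) y.
rewrite (_ : T (_ \+ _) y = 0); first by lra.
apply/eqP; rewrite eq_le upper_le_const ?upper_ge0// => z /=; by rewrite subrr.
Qed.

Lemma weakly_ergodic_top_class_absorbing : (0 < #|X|)%N ->
  weakly_ergodic T -> top_class_absorbing T.
Proof.
case/card_gt0P => x0 _ Twe.
pose z := [arg min_(x < x0) #|reachable_set x|].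
have zmin x : (#|reachable_set z| <= #|reachable_set x|)%N.
  by rewrite /z; case: arg_minnP => // i _; apply.
have zabs := weakly_ergodic_closed_absorbing Twe (reachable_set_closed z).
(* The set reachable from [w] lies in that of [z]; minimal cardinality makes them equal. *)
have back w : reaches T z w -> reaches T w z.
  move=> zw; have sub : reachable_set w \subset reachable_set z.
    by apply/fintype.subsetP => y; rewrite !inE; apply: connect_trans.
  have /eqP eq_wz : reachable_set w == reachable_set z.
    by rewrite eqEcard sub zmin.
  have : z \in reachable_set z by rewrite inE; apply: connect0.
  by rewrite -eq_wz inE.
have to_z y : reaches T y z.
  have [w] := closed_absorbing_meet (reachable_set_closed y) zabs.
  by rewrite !inE => yw /back; apply: connect_trans.
exists (reachable_set z) => //; split.
  (* Since every state reaches [z], its reachable set is its communication class. *)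
  apply/imsetP; exists z => //; apply/setP => y; rewrite !inE /communicate.
  by rewrite to_z andbT.
move=> _ /imsetP[y _ ->]; exists y, z; rewrite !inE /=.
by rewrite /communicate /reaches !connect0; split=> //; apply: to_z.
Qed.

End UpperTransitionOperator.

Theorem theorem14 (R : realType) (X : finType) (X_nonempty : (0 < #|X|)%N)
    (T : (X -> R) -> (X -> R)) (T_upper : upper_transition_operator T) :
  weakly_ergodic T <-> top_class_absorbing T.
Proof.
split; first exact: weakly_ergodic_top_class_absorbing.
exact: top_class_absorbing_weakly_ergodic.
Qed.
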